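(* Let $q\in\kappa$ be generic for $\Gamma$, let $(\bar V_i,A^i_j)$ be an $H$-representation of type $(\Gamma;q)$ and let $i,j,k\in I$ be distinct. Then the following three linear maps $\bar V_{i,j}\to\bar V_{i,k}$ coincide: $[1]$: $\bar V_{i,j}\xrightarrow{\,p^i_{i,k}\,}\bar V_{i,k}$ (restriction of $p^i_{i,k}$ to $\bar V_{i,j}\subset\bar V_i$); $[2]$: $\bar V_{i,j}\xrightarrow{\,A^i_k\,}\bar V_k\xrightarrow{\,p^k_{k,i}\,}\bar V_{k,i}\xrightarrow{\,A^k_i\,}\bar V_{i,k}$; $[3]$: $\bar V_{i,j}\xrightarrow{\,A^i_j\,}\bar V_{j,i}\xrightarrow{\,A^j_k\,}\bar V_k\xrightarrow{\,p^k_{k,i}\,}\bar V_{k,i}\xrightarrow{\,A^k_i\,}\bar V_{i,k}$.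
   Context: $I$ is a finite set, $\Gamma=[m_{i,j}]_{i,j\in I}$ a Coxeter matrix ($m_{i,i}=1$, $m_{i,j}=m_{j,i}\ge2$ finite integers for $i\ne j$), $\kappa$ a field; spaces are finite dimensional. The numbers $4\cos^2(a\pi/m)$, $m=m_{i,j}$, are regarded as elements of $\kappa$ (i.e. $2+\zeta^a+\zeta^{-a}$ with $\zeta$ a primitive $m$-th root of unity). $q\in\kappa\setminus\{0\}$ is generic if for all $i\ne j$ the dihedral Hecke algebra $H_q(I_{m_{i,j}})$ (generators $\sigma_1,\sigma_2$; $\sigma_1\sigma_2\cdots=\sigma_2\sigma_1\cdots$ with $m_{i,j}$ factors; $(\sigma_k-q)(\sigma_k+1)=0$) is semisimple. Put $\lambda_{m;q}(a)=4\cos^2(a\pi/m)\frac{1}{q+q^{-1}+2}$. $(m;q)$-couple: for linear $f:V\to W$, $g:W\to V$, $(f,g)$ is an $(m;q)$-couple between $V$ and $W$ if $gf$, $fg$ are diagonalizable with eigenvalues in $\{1\}\cup\{\lambda_{m;q}(a):1\le a\le[\frac{m-1}{2}]\}$ when $m$ is odd; for $m$ even the eigenvalue $0$ is also allowed, and then it is required that $gf(x)=0\Rightarrow f(x)=0$ and $fg(y)=0\Rightarrow g(y)=0$. $H$-representation of type $(\Gamma;q)$: spaces $\bar V_i$ ($i\in I$) and linear maps $A^i_j:\bar V_i\to\bar V_j$ ($i\ne j$) such that, with $\bar V_{i,j}=\ker(A^j_iA^i_j-\mathrm{id})\subset\bar V_i$: (a) $(A^i_j,A^j_i)$ is an $(m_{i,j};q)$-couple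 for all $i\ne j$; (b) $A^i_k(x)=A^j_kA^i_j(x)$ for distinct $i,j,k$ and $x\in\bar V_{i,j}$; (c) $\mathrm{Im}(A^k_j-A^i_jA^k_i)\subset\mathrm{Im}(\mathrm{id}_{\bar V_j}-A^i_jA^j_i)$ for distinct $i,j,k$. Let $\bar V_{i/j}=\mathrm{Im}(\mathrm{id}_{\bar V_i}-A^j_iA^i_j)$, the sum of the eigenspaces of $A^j_iA^i_j$ for eigenvalues $\ne1$. Then $\bar V_i=\bar V_{i,j}\oplus\bar V_{i/j}$, and $p^i_{i,j}:\bar V_i\to\bar V_{i,j}$ is the projection. $A^i_j$ restricts to an isomorphism $\bar V_{i,j}\to\bar V_{j,i}$ with inverse the restriction of $A^j_i$. *)

(* Defs.v *)
From HB Require Import structures.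
From mathcomp Require Import all_boot all_order all_algebra all_field.

Set Implicit Arguments.
Unset Strict Implicit.
Unset Printing Implicit Defensive.

Import GRing.Theory.
Local Open Scope ring_scope.

Definition coxeter_matrix (I : finType) (m : I -> I -> nat) : Prop :=
  [/\ forall i, m i i = 1%N,
      forall i j, m i j = m j i &
      forall i j, i != j -> (2 <= m i j)%N].

Section CosineValues.

(* A primitive m-th root of unity in the sense of reduction from Z[zeta_m]: a
   root of the m-th cyclotomic polynomial. If m is nonzero in L this is exactly
   m.-primitive_root (see mod_primitive_rootP); if the characteristic
   divides m, where no element of order m exists, it still gives a meaning to
   4 cos^2 (a pi / m), as the image of an algebraic integer. *)
Definition mod_primitive_root (L : fieldType) (m : nat) (z : L) : Prop :=
  root (map_poly intr 'Phi_m : {poly L}) z.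

Lemma mod_primitive_rootP (L : fieldType) (m : nat) (z : L) :
  m%:R != 0 :> L -> mod_primitive_root m z <-> m.-primitive_root z.
Proof.
move=> nz_m; have m_gt0 : (0 < m)%N by case: m nz_m => //; rewrite eqxx.
pose P d : {poly L} := map_poly intr 'Phi_d.
have prodP d : (0 < d)%N -> \prod_(e <- divisors d) P e = 'X^d - 1.
  move=> d_gt0; rewrite /P -rmorph_prod prod_Cyclotomic //.
  by rewrite rmorphB rmorph1 /= map_polyXn.
have unitE d : (0 < d)%N -> root ('X^d - 1 : {poly L}) z = (z ^+ d == 1).
  by move=> d_gt0; rewrite rootE !hornerE subr_eq0.
have divr d : (0 < d)%N -> root (P d) z -> z ^+ d = 1.
  move=> d_gt0 Pdz; apply/eqP; rewrite -unitE // -prodP // (big_rem d) /=.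
    by rewrite rootM Pdz.
  by rewrite -dvdn_divisors.
have root_prodP d : (0 < d)%N -> root ('X^d - 1 : {poly L}) z ->
    exists2 e, (e %| d)%N & root (P e) z.
  move=> d_gt0; rewrite -prodP // rootE horner_prod prodf_seq_eq0.
  by case/hasP=> e; rewrite -dvdn_divisors // => e_d Pez; exists e.
split=> [Pmz | prim_z].
- have zm1 := divr m m_gt0 Pmz.
  have [d prim_d d_m] := prim_order_exists m_gt0 zm1.
  have d_gt0 : (0 < d)%N := prim_order_gt0 prim_d.
  have [<- // | neq_dm] := eqVneq d m.
  have Rd : root ('X^d - 1 : {poly L}) z by rewrite unitE // prim_expr_order.
  have [e e_d Pez] := root_prodP d d_gt0 Rd.
  have neq_em : e != m.
    apply: contraNneq neq_dm => em; rewrite em in e_d.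
    by rewrite eqn_dvd d_m e_d.
  have := separable_Xn_sub_1 nz_m; rewrite -prodP //.
  rewrite (big_rem m) -?dvdn_divisors //= (big_rem e) /=; last first.
    rewrite rem_filter ?divisors_uniq // mem_filter /= neq_em.
    by rewrite -dvdn_divisors // (dvdn_trans e_d).
  rewrite mulrA separable_mul => /and3P[sep _ _]; move: sep.
  rewrite separable_mul => /and3P[_ _ cop].
  have := coprimep_root cop Pmz; by rewrite -rootE Pez.
- have Rm : root ('X^m - 1 : {poly L}) z by rewrite unitE // prim_expr_order.
  have [e e_m Pez] := root_prodP m m_gt0 Rm.
  have e_gt0 := dvdn_gt0 m_gt0 e_m.
  have /eqP := divr e e_gt0 Pez; rewrite -(prim_order_dvd prim_z) => m_e.
  by have /eqP <- : e == m by rewrite eqn_dvd e_m m_e.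
Qed.

(* c a is the element 4 cos^2 (a pi / m) of kappa; the root of unity itself may
   lie in an extension L. The set of values c a for 1 <= a <= (m - 1) / 2 does
   not depend on the choice of zeta. *)
Definition four_cos2 (kappa : fieldType) (m : nat) (c : nat -> kappa) : Prop :=
  exists (L : fieldType) (iota : {rmorphism kappa -> L}) (zeta : L),
    mod_primitive_root m zeta /\
    forall a, iota (c a) = 2 + zeta ^+ a + zeta ^- a.

End CosineValues.

Section DihedralHecke.

Variables (kappa : fieldType) (m : nat) (q : kappa).

(* x * y * x * ... with m factors *)
Definition alternating (B : algType kappa) (x y : B) : B :=
  \prod_(t < m) (if odd t then y else x).

Definition hecke_relations (B : algType kappa) (x y : B) : Prop :=
  [/\ alternating x y = alternating y x,
      (x - q%:A) * (x + 1) = 0 &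
      (y - q%:A) * (y + 1) = 0].

(* H is the algebra H_q(I_m) presented by the generators s1, s2 and the
   relations above, expressed by its universal property. *)
Definition is_dihedral_hecke (H : falgType kappa) (s1 s2 : H) : Prop :=
  [/\ hecke_relations s1 s2,
      forall (B : algType kappa) (x y : B), hecke_relations x y ->
        exists f : {lrmorphism H -> B}, f s1 = x /\ f s2 = y &
      forall (B : algType kappa) (f g : {lrmorphism H -> B}),
        f s1 = g s1 -> f s2 = g s2 -> f =1 g].

Definition left_ideal (H : falgType kappa) (J : {vspace H}) : Prop :=
  (fullv * J <= J)%VS.

Definition semisimple (H : falgType kappa) : Prop :=
  forall J : {vspace H}, left_ideal J ->
    exists K : {vspace H},
      [/\ left_ideal K, (J + K = fullv)%VS & (J :&: K = 0)%VS].

Definition dihedral_hecke_semisimple : Prop :=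
  exists (H : falgType kappa) (s1 s2 : H),
    is_dihedral_hecke s1 s2 /\ semisimple H.

End DihedralHecke.

Definition generic (kappa : fieldType) (I : finType) (m : I -> I -> nat)
    (q : kappa) : Prop :=
  q != 0 /\ forall i j, i != j -> dihedral_hecke_semisimple (m i j) q.

Definition diagonalizable_end (kappa : fieldType) (V : vectType kappa)
    (f : 'End(V)) : Prop :=
  exists2 b : seq V, basis_of fullv b &
    forall v, v \in b -> exists a : kappa, f v = a *: v.

Section Couples.

Variables (kappa : fieldType) (c : nat -> kappa) (m : nat) (q : kappa).

(* lambda_{m;q}(a), where c a stands for 4 cos^2 (a pi / m) *)
Definition lambda (a : nat) : kappa := c a * (q + q^-1 + 2)^-1.

Definition couple_eigenvalue (mu : kappa) : Prop :=
  [\/ mu = 1,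
      exists2 a, (1 <= a <= m.-1./2)%N & mu = lambda a |
      ~~ odd m /\ mu = 0].

Definition couple_end (V : vectType kappa) (h : 'End(V)) : Prop :=
  diagonalizable_end h /\
  forall mu, passmx.leigenvalue h mu -> couple_eigenvalue mu.

Definition couple (V W : vectType kappa)
    (f : 'Hom(V, W)) (g : 'Hom(W, V)) : Prop :=
  [/\ couple_end (g \o f)%VF,
      couple_end (f \o g)%VF &
      ~~ odd m -> (forall x, g (f x) = 0 -> f x = 0) /\
                  (forall y, f (g y) = 0 -> g y = 0)].

End Couples.

Section HRepresentations.

Variables (kappa : fieldType) (I : finType) (V : I -> vectType kappa).
(* A i j is A^i_j : V_i -> V_j; the values A i i play no role. *)
Variable A : forall i j, 'Hom(V i, V j).

(* V_{i,j} *)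
Definition Vfix (i j : I) : {vspace V i} := lker ((A j i \o A i j) - \1)%VF.

(* V_{i/j} *)
Definition Vmov (i j : I) : {vspace V i} := limg (\1 - (A j i \o A i j))%VF.

(* p^i_{i,j}, seen as an endomorphism of V_i *)
Definition pfix (i j : I) : 'End(V i) := daddv_pi (Vfix i j) (Vmov i j).

(* c m a stands for 4 cos^2 (a pi / m). *)
Definition Hrepresentation (m : I -> I -> nat) (c : nat -> nat -> kappa)
    (q : kappa) : Prop :=
  [/\ forall i j, i != j -> couple (c (m i j)) (m i j) q (A i j) (A j i),
      forall i j k, i != j -> i != k -> j != k ->
        forall x, x \in Vfix i j -> A i k x = A j k (A i j x) &
      forall i j k, i != j -> i != k -> j != k ->
        (limg (A k j - (A i j \o A k i))%VF <= Vmov j i)%VS].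

End HRepresentations.

(* Main.v *)
(* A^i_k intertwines A^k_i A^i_k with A^i_k A^k_i, so it respects the
   decompositions V_i = V_{i,k} + V_{i/k} and V_k = V_{k,i} + V_{k/i}: it commutes
   with the projections. Hence [2] is A^k_i A^i_k p^i_{i,k} = p^i_{i,k}, and
   condition (b) turns [3] into [2]. *)
Require Import Defs.
From HB Require Import structures.
From mathcomp Require Import all_boot all_order all_algebra all_field.
Set Implicit Arguments.
Unset Strict Implicit.
Unset Printing Implicit Defensive.
Import GRing.Theory.
Local Open Scope ring_scope.

Lemma daddv_piD (K : fieldType) (vT : vectType K) (U W : {vspace vT}) u w :
  (U :&: W = 0)%VS -> u \in U -> w \in W -> daddv_pi U W (u + w) = u.
Proof.
move=> dxUW Uu Ww; have dxWU : (W :&: U = 0)%VS by rewrite capvC.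
have UWw : w \in (U + W)%VS by apply: (subvP (addvSr U W)).
(* The two complementary projections of [w] add up to [w], and the one onto [W] already fixes [w];
   so its projection onto [U] is zero. *)
have := daddv_pi_add dxUW UWw; rewrite (daddv_pi_id dxWU Ww) => /(canRL (addrK _)).
by rewrite subrr linearD /= (daddv_pi_id dxUW Uu) => ->; rewrite addr0.
Qed.

Section Diagonalizable.

Variables (K : fieldType) (vT : vectType K) (f : 'End(vT)).
Hypothesis diag_f : diagonalizable_end f.

(** It suffices to place each vector of an eigenbasis: for eigenvalue 1 it lies in the kernel, and
    for [a != 1] it is the image under [\1 - f] of its multiple by [(1 - a)^-1]. *)
Lemma diagonalizable_fix_addv : (lker (f - \1)%VF + limg (\1 - f)%VF = fullv)%VS.
Proof.
have [b bP eig_b] := diag_f.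
apply/eqP; rewrite eqEsubv subvf -{1}(span_basis bP) /=.
apply/span_subvP => v /eig_b [a fv]; have [a1|a1] := eqVneq a 1.
  apply/(subvP (addvSl _ _)).
  by rewrite memv_ker !(add_lfunE, opp_lfunE, id_lfunE, comp_lfunE) /= fv a1 scale1r subrr.
apply: (subvP (addvSr _ _)).
have nz : 1 - a != 0 by rewrite subr_eq0 eq_sym.
suff -> : v = (\1 - f)%VF ((1 - a)^-1 *: v) by rewrite memv_img ?memvf.
rewrite linearZ /= add_lfunE opp_lfunE id_lfunE fv -{2}[v]scale1r -scalerBl scalerA.
by rewrite mulVf // scale1r.
Qed.

(** By rank-nullity for [\1 - f], whose kernel is that of [f - \1], the two dimensions add up to
    that of the whole space, which is already the sum; nothing is left for the intersection. *)
Lemma diagonalizable_fix_capv : (lker (f - \1)%VF :&: limg (\1 - f)%VF = 0)%VS.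
Proof.
have kerE : lker (\1 - f)%VF = lker (f - \1)%VF.
  by apply/vspaceP=> v; rewrite !memv_ker -opprB opp_lfunE oppr_eq0.
apply/eqP; rewrite -dimv_eq0.
have := limg_ker_dim (\1 - f)%VF fullv.
rewrite capfv kerE => dimE.
have := dimv_sum_cap (lker (f - \1)%VF) (limg (\1 - f)%VF).
by rewrite diagonalizable_fix_addv dimE -[RHS]addn0 => /eqP; rewrite eqn_add2l.
Qed.

End Diagonalizable.

Section Projections.

Variables (kappa : fieldType) (I : finType) (V : I -> vectType kappa).
Variable A : forall i j, 'Hom(V i, V j).

Lemma VfixP i j x : reflect (A j i (A i j x) = x) (x \in Vfix A i j).
Proof. by rewrite memv_ker !(add_lfunE, opp_lfunE, id_lfunE, comp_lfunE) /= subr_eq0; apply: eqP. Qed.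

Lemma mem_Vfix_A i j x : x \in Vfix A i j -> A i j x \in Vfix A j i.
Proof. by move=> /VfixP xE; apply/VfixP; rewrite xE. Qed.

Lemma mem_Vmov_A i j x : x \in Vmov A i j -> A i j x \in Vmov A j i.
Proof.
(* The witness comes from the identity [A i j (1 - A j i A i j) = (1 - A i j A j i) A i j]. *)
case/memv_imgP=> y _ ->; apply/memv_imgP; exists (A i j y); rewrite ?memvf //.
by rewrite !(add_lfunE, opp_lfunE, id_lfunE, comp_lfunE) linearB.
Qed.

Lemma A_pfix i j x :
    diagonalizable_end (A j i \o A i j)%VF ->
    diagonalizable_end (A i j \o A j i)%VF ->
  pfix A j i (A i j x) = A i j (pfix A i j x).
Proof.
move=> diag_ij diag_ji.
have : x \in (Vfix A i j + Vmov A i j)%VS.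
  by rewrite diagonalizable_fix_addv ?memvf.
case/memv_addP=> u Uu [w Ww ->].
(* Since [A i j u + A i j w] is split along [Vfix A j i] and [Vmov A j i], both projections can be
   read off; the two trivial intersections remain. *)
rewrite /pfix linearD /= !daddv_piD ?mem_Vfix_A ?mem_Vmov_A //.
  exact: diagonalizable_fix_capv.
exact: diagonalizable_fix_capv.
Qed.

End Projections.

Theorem lemma5p1 (kappa : fieldType) (I : finType) (m : I -> I -> nat)
    (c : nat -> nat -> kappa) (q : kappa)
    (V : I -> vectType kappa) (A : forall i j : I, 'Hom(V i, V j))
    (hm : coxeter_matrix m)
    (hc : forall i j : I, i != j -> four_cos2 (m i j) (c (m i j)))
    (hq : generic m q)
    (hA : Hrepresentation A m c q)
    (i j k : I) (hij : i != j) (hik : i != k) (hjk : j != k)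
    (x : V i) (hx : x \in Vfix A i j) :
  [/\ pfix A i k x \in Vfix A i k,
      A i j x \in Vfix A j i,
      A k i (pfix A k i (A i k x)) = pfix A i k x &
      A k i (pfix A k i (A j k (A i j x))) = pfix A i k x].
Proof.
have [Acpl A_b _] := hA; have [[diag_ik _] [diag_ki _] _] := Acpl i k hik.
have pfix_x : pfix A i k x \in Vfix A i k by apply: memv_pi.
have map2 : A k i (pfix A k i (A i k x)) = pfix A i k x.
  by rewrite A_pfix //; apply/VfixP.
by split; rewrite ?mem_Vfix_A // -A_b.
Qed.
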